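(* Each of the following subsets of $TLeib_7$ is a single orbit (i.e. any two of its members are isomorphic and it contains every algebra of $TLeib_7$ isomorphic to one of its members), with the indicated representative: $U_7^6$: $L(1,0,0,0,0,0,1)$; $U_7^7$: $L(0,0,0,0,0,0,1)$; $U_7^{11}$: $L(0,0,0,1,0,1,0)$; $U_7^{12}$: $L(0,0,0,1,0,0,0)$; $U_7^{15}$: $L(1,0,1,0,0,0,0)$; $U_7^{16}$: $L(0,0,1,0,0,0,0)$; $U_7^{18}$: $L(0,1,0,0,1,0,0)$; $U_7^{19}$: $L(0,1,0,0,0,0,0)$; $U_7^{21}$: $L(1,0,0,0,1,0,0)$; $U_7^{22}$: $L(1,0,0,0,0,0,0)$; $U_7^{23}$: $L(0,0,0,0,1,1,0)$; $U_7^{24}$: $L(0,0,0,0,0,1,0)$; $U_7^{25}$: $L(0,0,0,0,1,0,0)$; $U_7^{26}$: $L(0,0,0,0,0,0,0)$.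
   Context: All algebras are over $\mathbb{C}$. For $C=(c_{0,0},c_{0,1},c_{1,1},c_{1,2},c_{1,3},c_{1,4},c_{2,3})\in\mathbb{C}^7$, $L(C)$ denotes the $7$-dimensional complex (Leibniz) algebra with basis $e_0,e_1,\dots,e_6$ and products (products of basis vectors not listed are zero): $[e_i,e_0]=e_{i+1}$ for $1\le i\le 5$; $[e_0,e_i]=-e_{i+1}$ for $2\le i\le 5$; $[e_0,e_0]=c_{0,0}e_6$; $[e_0,e_1]=-e_2+c_{0,1}e_6$; $[e_1,e_1]=c_{1,1}e_6$; $[e_1,e_2]=-[e_2,e_1]=c_{1,2}e_4+c_{1,3}e_5+c_{1,4}e_6$; $[e_1,e_3]=-[e_3,e_1]=c_{1,2}e_5+c_{1,3}e_6$; $[e_1,e_4]=-[e_4,e_1]=(c_{1,2}-c_{2,3})e_6$; $[e_2,e_3]=-[e_3,e_2]=c_{2,3}e_6$. $TLeib_7$ is the set of all $L(C)$, $C\in\mathbb{C}^7$. ''Isomorphic'' means isomorphic as algebras over $\mathbb{C}$. The subsets are the sets of $L(C)\in TLeib_7$ satisfying: $U_7^6$: $c_{2,3}\ne0$, $c_{1,1}=c_{0,1}=c_{1,2}=c_{1,3}=0$, $c_{0,0}\ne0$. $U_7^7$: $c_{2,3}\ne0$, $c_{1,1}=c_{0,1}=c_{1,2}=c_{1,3}=c_{0,0}=0$. $U_7^{11}$: $c_{2,3}=0$, $c_{1,2}\ne0$, $c_{1,1}=c_{0,1}=c_{0,0}=0$, $4c_{1,4}c_{1,2}-5c_{1,3}^2\ne0$.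 $U_7^{12}$: $c_{2,3}=0$, $c_{1,2}\ne0$, $c_{1,1}=c_{0,1}=c_{0,0}=0$, $4c_{1,4}c_{1,2}-5c_{1,3}^2=0$. $U_7^{15}$: $c_{2,3}=c_{1,2}=0$, $c_{1,1}\ne0$, $c_{1,4}=c_{1,3}=0$, $4c_{0,0}c_{1,1}-c_{0,1}^2\ne0$. $U_7^{16}$: $c_{2,3}=c_{1,2}=0$, $c_{1,1}\ne0$, $c_{1,4}=c_{1,3}=0$, $4c_{0,0}c_{1,1}-c_{0,1}^2=0$. $U_7^{18}$: $c_{2,3}=c_{1,2}=c_{1,1}=0$, $c_{0,1}\ne0$, $c_{1,4}=0$, $c_{1,3}\ne0$. $U_7^{19}$: $c_{2,3}=c_{1,2}=c_{1,1}=0$, $c_{0,1}\ne0$, $c_{1,4}=c_{1,3}=0$. $U_7^{21}$: $c_{2,3}=c_{1,2}=c_{1,1}=c_{0,1}=0$, $c_{0,0}\ne0$, $c_{1,4}=0$, $c_{1,3}\ne0$. $U_7^{22}$: $c_{2,3}=c_{1,2}=c_{1,1}=c_{0,1}=0$, $c_{0,0}\ne0$, $c_{1,4}=c_{1,3}=0$. $U_7^{23}$: $c_{2,3}=c_{1,2}=c_{1,1}=c_{0,1}=c_{0,0}=0$, $c_{1,4}\ne0$, $c_{1,3}\ne0$. $U_7^{24}$: $c_{2,3}=c_{1,2}=c_{1,1}=c_{0,1}=c_{0,0}=0$, $c_{1,4}\ne0$, $c_{1,3}=0$. $U_7^{25}$: $c_{2,3}=c_{1,2}=c_{1,1}=c_{0,1}=c_{0,0}=c_{1,4}=0$,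 $c_{1,3}\ne0$. $U_7^{26}$: $c_{2,3}=c_{1,2}=c_{1,1}=c_{0,1}=c_{0,0}=c_{1,4}=c_{1,3}=0$. *)

(* Defs.v *)
From HB Require Import structures.
From mathcomp Require Import all_boot all_order all_algebra.
From mathcomp Require Import boolp classical_sets reals.
From mathcomp Require Import complex.

Set Implicit Arguments.
Unset Strict Implicit.
Unset Printing Implicit Defensive.

Import GRing.Theory.
Local Open Scope ring_scope.
Local Open Scope classical_set_scope.

(* An algebra is a vector space V with a product V -> V -> V; the products
   used below are bilinear by construction. *)
Definition alg_isomorphic (K : fieldType) (V W : lmodType K)
    (mV : V -> V -> V) (mW : W -> W -> W) : Prop :=
  exists2 f : {linear V -> W},
    bijective f & forall x y : V, f (mV x y) = mW (f x) (f y).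

Record params (K : Type) := Params {
  c00 : K; c01 : K; c11 : K; c12 : K; c13 : K; c14 : K; c23 : K }.

Section TLeib.
Variable K : fieldType.

Implicit Type c : params K.

(* inord is only meaningful here for k <= 6. *)
Definition e_ (k : nat) : 'rV[K]_7 := delta_mx 0 (inord k).

Definition L_basis c (i j : nat) : 'rV[K]_7 :=
  match i, j with
  | 1%N, 0%N => e_ 2
  | 2%N, 0%N => e_ 3
  | 3%N, 0%N => e_ 4
  | 4%N, 0%N => e_ 5
  | 5%N, 0%N => e_ 6
  | 0%N, 2%N => - e_ 3
  | 0%N, 3%N => - e_ 4
  | 0%N, 4%N => - e_ 5
  | 0%N, 5%N => - e_ 6
  | 0%N, 0%N => c00 c *: e_ 6
  | 0%N, 1%N => - e_ 2 + c01 c *: e_ 6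
  | 1%N, 1%N => c11 c *: e_ 6
  | 1%N, 2%N => c12 c *: e_ 4 + c13 c *: e_ 5 + c14 c *: e_ 6
  | 2%N, 1%N => - (c12 c *: e_ 4 + c13 c *: e_ 5 + c14 c *: e_ 6)
  | 1%N, 3%N => c12 c *: e_ 5 + c13 c *: e_ 6
  | 3%N, 1%N => - (c12 c *: e_ 5 + c13 c *: e_ 6)
  | 1%N, 4%N => (c12 c - c23 c) *: e_ 6
  | 4%N, 1%N => - ((c12 c - c23 c) *: e_ 6)
  | 2%N, 3%N => c23 c *: e_ 6
  | 3%N, 2%N => - (c23 c *: e_ 6)
  | _, _ => 0
  end.

Definition L c (x y : 'rV[K]_7) : 'rV[K]_7 :=
  \sum_(i < 7) \sum_(j < 7) (x 0 i * y 0 j) *: L_basis c i j.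

Definition alg7 := 'rV[K]_7 -> 'rV[K]_7 -> 'rV[K]_7.

Definition TLeib7 : set alg7 := range L.

Definition U7_6 : set alg7 := [set L c | c in [set c : params K |
  c23 c != 0 /\ c11 c = 0 /\ c01 c = 0 /\ c12 c = 0 /\ c13 c = 0 /\
  c00 c != 0]].

Definition U7_7 : set alg7 := [set L c | c in [set c : params K |
  c23 c != 0 /\ c11 c = 0 /\ c01 c = 0 /\ c12 c = 0 /\ c13 c = 0 /\
  c00 c = 0]].

Definition U7_11 : set alg7 := [set L c | c in [set c : params K |
  c23 c = 0 /\ c12 c != 0 /\ c11 c = 0 /\ c01 c = 0 /\ c00 c = 0 /\
  4 * c14 c * c12 c - 5 * c13 c ^+ 2 != 0]].

Definition U7_12 : set alg7 := [set L c | c in [set c : params K |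
  c23 c = 0 /\ c12 c != 0 /\ c11 c = 0 /\ c01 c = 0 /\ c00 c = 0 /\
  4 * c14 c * c12 c - 5 * c13 c ^+ 2 = 0]].

Definition U7_15 : set alg7 := [set L c | c in [set c : params K |
  c23 c = 0 /\ c12 c = 0 /\ c11 c != 0 /\ c14 c = 0 /\ c13 c = 0 /\
  4 * c00 c * c11 c - c01 c ^+ 2 != 0]].

Definition U7_16 : set alg7 := [set L c | c in [set c : params K |
  c23 c = 0 /\ c12 c = 0 /\ c11 c != 0 /\ c14 c = 0 /\ c13 c = 0 /\
  4 * c00 c * c11 c - c01 c ^+ 2 = 0]].

Definition U7_18 : set alg7 := [set L c | c in [set c : params K |
  c23 c = 0 /\ c12 c = 0 /\ c11 c = 0 /\ c01 c != 0 /\ c14 c = 0 /\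
  c13 c != 0]].

Definition U7_19 : set alg7 := [set L c | c in [set c : params K |
  c23 c = 0 /\ c12 c = 0 /\ c11 c = 0 /\ c01 c != 0 /\ c14 c = 0 /\
  c13 c = 0]].

Definition U7_21 : set alg7 := [set L c | c in [set c : params K |
  c23 c = 0 /\ c12 c = 0 /\ c11 c = 0 /\ c01 c = 0 /\ c00 c != 0 /\
  c14 c = 0 /\ c13 c != 0]].

Definition U7_22 : set alg7 := [set L c | c in [set c : params K |
  c23 c = 0 /\ c12 c = 0 /\ c11 c = 0 /\ c01 c = 0 /\ c00 c != 0 /\
  c14 c = 0 /\ c13 c = 0]].

Definition U7_23 : set alg7 := [set L c | c in [set c : params K |
  c23 c = 0 /\ c12 c = 0 /\ c11 c = 0 /\ c01 c = 0 /\ c00 c = 0 /\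
  c14 c != 0 /\ c13 c != 0]].

Definition U7_24 : set alg7 := [set L c | c in [set c : params K |
  c23 c = 0 /\ c12 c = 0 /\ c11 c = 0 /\ c01 c = 0 /\ c00 c = 0 /\
  c14 c != 0 /\ c13 c = 0]].

Definition U7_25 : set alg7 := [set L c | c in [set c : params K |
  c23 c = 0 /\ c12 c = 0 /\ c11 c = 0 /\ c01 c = 0 /\ c00 c = 0 /\
  c14 c = 0 /\ c13 c != 0]].

Definition U7_26 : set alg7 := [set L c | c in [set c : params K |
  c23 c = 0 /\ c12 c = 0 /\ c11 c = 0 /\ c01 c = 0 /\ c00 c = 0 /\
  c14 c = 0 /\ c13 c = 0]].

Definition single_orbit (U : set alg7) (A : alg7) : Prop :=
  [/\ U A,
      forall X Y : alg7, U X -> U Y -> alg_isomorphic X Y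
    & forall X Y : alg7, TLeib7 X -> U Y -> alg_isomorphic X Y -> U X].

End TLeib.

(* Main.v *)
Require Import Defs.
From HB Require Import structures.
From mathcomp Require Import all_boot all_order all_algebra.
From mathcomp Require Import boolp classical_sets reals.
From mathcomp Require Import complex.
From mathcomp Require Import ring.

(** Every basis of L(c) that satisfies the multiplication table of some L(c')
    is determined by the images a = a0 e0 + a1 e1 + ... of e0 and
    b = b1 e1 + b2 e2 + ... of e1, since e_{k+1} = [e_k, e0] for k >= 1. The
    e0-coordinate of b must vanish: an isomorphism sends [e1, e2], which lies in
    span(e4, e5, e6), to [b, [b, a]], whose e3-coordinate is a nonzero multiple
    of that coordinate; bijectivity then forces a0 and b1 to be nonzero.
    Comparing coordinates in the relations [e0,e0], [e0,e1], [e1,e1], [e1,e2]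
    and [e2,e3] expresses c' by explicit rational functions of c, a0, a1, b1
    ([change]). The remaining coordinates of a and b survive only in c14, and
    only through one multiple t of c23. Conversely every choice of a0, b1
    nonzero, a1 and t is realised by a triangular matrix, b3 being used to
    produce t. Therefore L(c') is isomorphic to L(c) exactly when
    c' = change a0 a1 b1 t c ([isomorphic_change], [change_of_isomorphic]).

    This turns the orbit claims into algebra in C^7. The conditions that cut out
    each subset are stable under [change], because the entries involved get
    multiplied by nonzero scalars once the entries required to vanish are zero;
    so are the two quadratic expressions, which behave like discriminants
    ([change_disc_c12], [change_disc_c11]). And the four parameters suffice to
    reach the representative: t removes c14 when c23 is nonzero, a1 completes a
    square or solves a linear equation, and a0, b1 rescale the surviving entries
    to 1, where a0 may have to be a root, which exists over an algebraically
    closed field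
    ([single_orbit_change] and the lemmas [single_orbit_U7_n]). *)

Set Implicit Arguments.
Unset Strict Implicit.
Unset Printing Implicit Defensive.

Import GRing.Theory Num.Theory.
Local Open Scope ring_scope.

(** * Isomorphism of algebras is an equivalence *)

Section IsoEquivalence.
Variable K : fieldType.

Lemma alg_isomorphic_sym (V W : lmodType K)
    (mV : V -> V -> V) (mW : W -> W -> W) :
  alg_isomorphic mV mW -> alg_isomorphic mW mV.
Proof.
case=> f [g fK gK] fM.
pose G : {linear W -> V} :=
  HB.pack g (GRing.isLinear.Build _ _ _ _ g (can2_linear fK gK)).
exists G => [|x y]; first by exists f.
by apply: (can_inj fK); rewrite fM /= !gK.
Qed.

Lemma alg_isomorphic_trans (U V W : lmodType K) (mU : U -> U -> U)
    (mV : V -> V -> V) (mW : W -> W -> W) :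
  alg_isomorphic mU mV -> alg_isomorphic mV mW -> alg_isomorphic mU mW.
Proof.
move=> [f fB fM] [g gB gM]; exists (g \o f) => [|x y /=]; first exact: bij_comp.
by rewrite fM gM.
Qed.

End IsoEquivalence.

(** * The product of L(c) in coordinates *)

Section Coordinates.
Variable K : fieldType.
Implicit Type c : params K.

(** Coordinates past the end of the sequence are zero. *)
Definition row7 (s : seq K) : 'rV[K]_7 := \row_k s`_k.

(** Writing a vector as an explicit list lets [L_row7] compute products by
    rewriting. *)
Lemma row7P (x : 'rV[K]_7) : exists x0 x1 x2 x3 x4 x5 x6,
  x = row7 [:: x0; x1; x2; x3; x4; x5; x6].
Proof.
exists (x 0 (inord 0)), (x 0 (inord 1)), (x 0 (inord 2)), (x 0 (inord 3)).
exists (x 0 (inord 4)), (x 0 (inord 5)), (x 0 (inord 6)).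
apply/rowP=> k; rewrite mxE -{1}(inord_val k).
by case: k => -[|[|[|[|[|[|[|k]]]]]]] lt_k7.
Qed.

Lemma e_row7 k : (k < 7)%N -> e_ K k = row7 (mkseq (fun i => (i == k)%:R) 7).
Proof.
move=> lt_k7; apply/rowP=> i; rewrite !mxE nth_mkseq //=.
by rewrite -val_eqE /= inordK.
Qed.

Lemma L_row7 c x0 x1 x2 x3 x4 x5 x6 y0 y1 y2 y3 y4 y5 y6 :
  L c (row7 [:: x0; x1; x2; x3; x4; x5; x6])
      (row7 [:: y0; y1; y2; y3; y4; y5; y6]) =
  row7 [:: 0; 0;
    x1 * y0 - x0 * y1;
    x2 * y0 - x0 * y2;
    x3 * y0 - x0 * y3 + c12 c * (x1 * y2 - x2 * y1);
    x4 * y0 - x0 * y4 + c13 c * (x1 * y2 - x2 * y1)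
      + c12 c * (x1 * y3 - x3 * y1);
    x5 * y0 - x0 * y5 + c14 c * (x1 * y2 - x2 * y1)
      + c13 c * (x1 * y3 - x3 * y1)
      + (c12 c - c23 c) * (x1 * y4 - x4 * y1) + c23 c * (x2 * y3 - x3 * y2)
      + c00 c * x0 * y0 + c01 c * x0 * y1 + c11 c * x1 * y1].
Proof.
rewrite /L !big_ord_recl !big_ord0 /= !mxE /= /bump /=.
rewrite ?add1n !e_row7 //.
apply/rowP=> k; rewrite !mxE /=.
by case: k => -[|[|[|[|[|[|[|k]]]]]]] lt_k7 //=; ring.
Qed.


Lemma L_e_ c i j : (i < 7)%N -> (j < 7)%N ->
  L c (e_ K i) (e_ K j) = L_basis c i j.
Proof.
move=> lt_i7 lt_j7; rewrite /L (bigD1 (inord i)) //= (bigD1 (inord j)) //=.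
rewrite big1 => [|k kj]; last first.
  by rewrite !mxE (negPf kj) andbF mulr0 scale0r.
rewrite big1 => [|k ki]; last first.
  by rewrite big1 // => l _; rewrite !mxE (negPf ki) mul0r scale0r.
by rewrite !mxE !eqxx mulr1 scale1r !addr0 !inordK.
Qed.

Lemma L_suml c (a : 'I_7 -> K) (u : 'I_7 -> 'rV[K]_7) y :
  L c (\sum_i a i *: u i) y = \sum_i a i *: L c (u i) y.
Proof.
rewrite /L; under [RHS]eq_bigr => i _ do rewrite scaler_sumr.
rewrite [RHS]exchange_big; apply: eq_bigr => k _ /=.
under [RHS]eq_bigr => i _ do rewrite scaler_sumr.
rewrite [RHS]exchange_big; apply: eq_bigr => l _ /=.
rewrite summxE mulr_suml scaler_suml; apply: eq_bigr => i _.
by rewrite mxE scalerA mulrA.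
Qed.

Lemma L_sumr c (a : 'I_7 -> K) (u : 'I_7 -> 'rV[K]_7) x :
  L c x (\sum_i a i *: u i) = \sum_i a i *: L c x (u i).
Proof.
rewrite /L; under [RHS]eq_bigr => i _ do rewrite scaler_sumr.
rewrite [RHS]exchange_big; apply: eq_bigr => k _ /=.
under [RHS]eq_bigr => i _ do rewrite scaler_sumr.
rewrite [RHS]exchange_big; apply: eq_bigr => l _ /=.
rewrite summxE mulr_sumr scaler_suml; apply: eq_bigr => i _.
by rewrite mxE scalerA mulrCA.
Qed.

(** By bilinearity it is enough to check an isomorphism on basis vectors: the
    rows of [M] form a basis of L(c) with the multiplication table of L(c'). *)
Lemma alg_isomorphic_basis c c' (M : 'M[K]_7) : M \in unitmx ->
    (forall i j, L c (row i M) (row j M) = L_basis c' i j *m M) ->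
  alg_isomorphic (L c') (L c).
Proof.
move=> Mu ML; exists (mulmxr M).
  by exists (mulmxr (invmx M)) => x /=; rewrite ?mulmxK ?mulmxKV.
move=> x y /=; rewrite (mulmx_sum_row x) (mulmx_sum_row y).
rewrite L_suml {1}/L mulmx_suml; apply: eq_bigr => i _.
rewrite L_sumr mulmx_suml scaler_sumr; apply: eq_bigr => j _.
by rewrite ML -scalemxAl scalerA.
Qed.
End Coordinates.

(** * The action of a change of adapted basis on the parameters *)

Section Change.
Variable K : fieldType.
Implicit Type c : params K.

(** The parameters of L(c) with respect to a basis that starts with
    a0 e0 + a1 e1 + ... and b1 e1 + .... The scalar [t] collects all that
    multiplies c23 in the new c14: this is the only place where the other
    coordinates of these two vectors matter. *)
Definition change (a0 a1 b1 t : K) c : params K := Params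
  ((a0 ^+ 2 * c00 c + a0 * a1 * c01 c + a1 ^+ 2 * c11 c) / (a0 ^+ 5 * b1))
  ((a0 * c01 c + 2 * a1 * c11 c) / a0 ^+ 5)
  (b1 * c11 c / a0 ^+ 5)
  (b1 * c12 c / a0 ^+ 2)
  (b1 * (a0 * c13 c + 2 * a1 * c12 c ^+ 2) / a0 ^+ 4)
  ((b1 * (a0 ^+ 2 * c14 c + 5 * a0 * a1 * c12 c * c13 c
          + 5 * a1 ^+ 2 * c12 c ^+ 3)
    + t * c23 c) / a0 ^+ 6)
  (b1 * c23 c / a0 ^+ 2).

(** The basis starts with a0 e0 + a1 e1 and b1 e1 + b3 e3 and continues with
    e_{k+1} = [e_k, e_0]; a single extra coordinate b3 is enough to realise any
    prescribed [t]. *)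
Lemma isomorphic_change (a0 a1 b1 t : K) c : 2 != 0 :> K -> a0 != 0 -> b1 != 0 ->
  alg_isomorphic (L (change a0 a1 b1 t c)) (L c).
Proof.
move=> nz2 nza nzb.
(* The solution of t = - 2 a0^2 b3 - a1 b1 (a0 c13 + a1 c12^2), which is what
   the e6-coordinate of [e1, e2] requires when the new e1 is b1 e1 + b3 e3. *)
pose b3 := - (t + a1 * b1 * (a1 * c12 c ^+ 2 + a0 * c13 c)) / (2 * a0 ^+ 2).
pose B : seq (seq K) := [::
  [:: a0; a1; 0; 0; 0; 0; 0];
  [:: 0; b1; 0; b3; 0; 0; 0];
  [:: 0; 0; a0 * b1; 0; a0 * b3; - (a1 * b3 * c12 c);
      a1 * b1 * c11 c - a1 * b3 * c13 c];
  [:: 0; 0; 0; a0 ^+ 2 * b1; - (a0 * a1 * b1 * c12 c);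
      a0 ^+ 2 * b3 - a0 * a1 * b1 * c13 c;
      a0 * a1 * b3 * (c23 c - 2 * c12 c) - a0 * a1 * b1 * c14 c];
  [:: 0; 0; 0; 0; a0 ^+ 3 * b1; - (2 * a0 ^+ 2 * a1 * b1 * c12 c);
      a0 * a1 ^+ 2 * b1 * c12 c * (c12 c - c23 c)
      - 2 * a0 ^+ 2 * a1 * b1 * c13 c + a0 ^+ 3 * b3];
  [:: 0; 0; 0; 0; 0; a0 ^+ 4 * b1;
      a0 ^+ 3 * a1 * b1 * (c23 c - 3 * c12 c)];
  [:: 0; 0; 0; 0; 0; 0; a0 ^+ 5 * b1]].
pose M := \matrix_(i < 7) row7 (nth [::] B i).
have rowM i : row i M = row7 (nth [::] B i) by rewrite rowK.
have eM k : (k < 7)%N -> e_ K k *m M = row7 (nth [::] B k).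
  by move=> lt_k7; rewrite -rowE rowM inordK.
apply: (alg_isomorphic_basis (M := M)) => [|i j].
  rewrite unitmxE -det_tr det_trig; last first.
    apply/is_trig_mxP=> i j; rewrite !mxE.
    by case: i j => -[|[|[|[|[|[|[|i]]]]]]] lt_i7
      [[|[|[|[|[|[|[|j]]]]]]] lt_j7].
  rewrite !big_ord_recl big_ord0 !mxE /= unitfE.
  by rewrite !mulf_neq0 ?expf_neq0 ?oner_neq0.
rewrite !rowM.
case: i j => -[|[|[|[|[|[|[|i]]]]]]] // lt_i7
  [[|[|[|[|[|[|[|j]]]]]]] // lt_j7];
  rewrite L_row7 /= ?(mulmxDl, mulNmx, mul0mx, =^~ scalemxAl, eM) //;
  apply/rowP=> k; rewrite !mxE;
  case: k => -[|[|[|[|[|[|[|k]]]]]]] // lt_k7 /=;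
  rewrite ?(mulr0, mul0r, subr0, addr0) //;
  rewrite ?/b3; field; rewrite ?nz2 ?nza ?nzb //.
Qed.

(** With D = b1 a0 - b0 a1, the image of e_k starts with D a0^(k-2) e_k for
    k >= 2. So injectivity at e6 makes D and a0 nonzero, and the e3-coordinate
    of the image of [e1, e2], which is - b0 D, must vanish. *)
Lemma morphism_triangular c c' (f : {linear 'rV[K]_7 -> 'rV[K]_7}) :
    injective f -> (forall x y, f (L c' x y) = L c (f x) (f y)) ->
  exists a0 a1 a2 a3 a4 a5 a6 b1 b2 b3 b4 b5 b6,
    [/\ f (e_ K 0) = row7 [:: a0; a1; a2; a3; a4; a5; a6],
        f (e_ K 1) = row7 [:: 0; b1; b2; b3; b4; b5; b6], a0 != 0 & b1 != 0].
Proof.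
move=> f_inj fM.
have fL i j : (i < 7)%N -> (j < 7)%N ->
    f (L_basis c' i j) = L c (f (e_ K i)) (f (e_ K j)).
  by move=> i7 j7; rewrite -L_e_.
have [a0 [a1 [a2 [a3 [a4 [a5 [a6 E0]]]]]]] := row7P (f (e_ K 0)).
have [b0 [b1 [b2 [b3 [b4 [b5 [b6 E1]]]]]]] := row7P (f (e_ K 1)).
pose D := b1 * a0 - b0 * a1.
have [p3 [p4 [p5 [p6 E2]]]] : exists p3 p4 p5 p6,
    f (e_ K 2) = row7 [:: 0; 0; D; p3; p4; p5; p6].
  by do 4 eexists; rewrite (fL 1 0) // E0 E1 L_row7; reflexivity.
have [q4 [q5 [q6 E3]]] : exists q4 q5 q6,
    f (e_ K 3) = row7 [:: 0; 0; 0; D * a0; q4; q5; q6].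
  do 3 eexists; rewrite (fL 2 0) // E0 E2 L_row7; congr row7.
  by congr [:: _; _; _; _; _; _; _]; first [reflexivity | ring].
have [r5 [r6 E4]] : exists r5 r6,
    f (e_ K 4) = row7 [:: 0; 0; 0; 0; D * a0 ^+ 2; r5; r6].
  do 2 eexists; rewrite (fL 3 0) // E0 E3 L_row7; congr row7.
  by congr [:: _; _; _; _; _; _; _]; first [reflexivity | ring].
have [s6 E5] : exists s6, f (e_ K 5) = row7 [:: 0; 0; 0; 0; 0; D * a0 ^+ 3; s6].
  eexists; rewrite (fL 4 0) // E0 E4 L_row7; congr row7.
  by congr [:: _; _; _; _; _; _; _]; first [reflexivity | ring].
have E6 : f (e_ K 6) = row7 [:: 0; 0; 0; 0; 0; 0; D * a0 ^+ 4].
  rewrite (fL 5 0) // E0 E5 L_row7; congr row7.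
  by congr [:: _; _; _; _; _; _; _]; ring.
have : D * a0 ^+ 4 != 0.
  apply: contraTneq isT => Da0; have /rowP/(_ (inord 6)) : e_ K 6 = 0.
    apply: f_inj; rewrite linear0 E6 Da0; apply/rowP=> k; rewrite !mxE.
    by case: k => -[|[|[|[|[|[|[|k]]]]]]].
  by rewrite !mxE !eqxx => /eqP; rewrite oner_eq0.
rewrite mulf_eq0 expf_eq0 /= negb_or => /andP[nzD nza].
have b0_eq0 : b0 = 0.
  have := fL 1 2 isT isT; rewrite /= !linearD !linearZ E1 E2 E4 E5 E6 L_row7.
  move/rowP/(_ (Ordinal (isT : 3 < 7)%N)); rewrite !mxE /=.
  rewrite !mulr0 !addr0 sub0r => /esym/eqP.
  by rewrite oppr_eq0 mulf_eq0 (negPf nzD) orbF => /eqP.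
exists a0, a1, a2, a3, a4, a5, a6, b1, b2, b3, b4, b5, b6.
split=> //; first by rewrite E1 b0_eq0.
by apply: contraNneq nzD => b1_eq0; rewrite /D b0_eq0 b1_eq0 !mul0r subr0.
Qed.

(** Compare coordinates of the images of [e0,e0], [e0,e1], [e1,e1], [e2,e3] at
    e6 and of [e1,e2] at e4, e5, e6. For [e0,e1] the antisymmetric part is
    eliminated by adding the relation for [e1,e0]. *)
Lemma change_of_isomorphic c c' : alg_isomorphic (L c') (L c) ->
  exists a0 a1 b1 t, [/\ a0 != 0, b1 != 0 & c' = change a0 a1 b1 t c].
Proof.
case=> f [g fK _] fM.
have [a0 [a1 [a2 [a3 [a4 [a5 [a6 H]]]]]]] := morphism_triangular (can_inj fK) fM.
have {H} [b1 [b2 [b3 [b4 [b5 [b6 [E0 E1 nza nzb]]]]]]] := H.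
have fL i j : (i < 7)%N -> (j < 7)%N ->
    f (L_basis c' i j) = L c (f (e_ K i)) (f (e_ K j)).
  by move=> i7 j7; rewrite -L_e_.
have [p5 [p6 E2]] : exists p5 p6, f (e_ K 2) =
    row7 [:: 0; 0; a0 * b1; a0 * b2;
      a0 * b3 + c12 c * (a2 * b1 - a1 * b2); p5; p6].
  do 2 eexists; rewrite (fL 1 0) // E0 E1 L_row7; congr row7.
  by congr [:: _; _; _; _; _; _; _]; first [reflexivity | ring].
have [q6 E3] : exists q6, f (e_ K 3) =
    row7 [:: 0; 0; 0; a0 ^+ 2 * b1; a0 ^+ 2 * b2 - a0 * a1 * b1 * c12 c;
      a0 ^+ 2 * b3 + a0 * c12 c * (a2 * b1 - 2 * a1 * b2)
      - a0 * a1 * b1 * c13 c; q6].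
  eexists; rewrite (fL 2 0) // E0 E2 L_row7; congr row7.
  by congr [:: _; _; _; _; _; _; _]; first [reflexivity | ring].
have E4 : f (e_ K 4) = row7 [:: 0; 0; 0; 0; a0 ^+ 3 * b1;
      a0 ^+ 3 * b2 - 2 * a0 ^+ 2 * a1 * b1 * c12 c;
      a0 ^+ 3 * b3 + a0 ^+ 2 * c12 c * (a2 * b1 - 3 * a1 * b2)
      + a0 ^+ 2 * c23 c * (a1 * b2 - a2 * b1) - 2 * a0 ^+ 2 * a1 * b1 * c13 c
      + a0 * a1 ^+ 2 * b1 * c12 c * (c12 c - c23 c)].
  rewrite (fL 3 0) // E0 E3 L_row7; congr row7.
  by congr [:: _; _; _; _; _; _; _]; ring.
have E5 : f (e_ K 5) = row7 [:: 0; 0; 0; 0; 0; a0 ^+ 4 * b1;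
      a0 ^+ 4 * b2 + a0 ^+ 3 * a1 * b1 * (c23 c - 3 * c12 c)].
  rewrite (fL 4 0) // E0 E4 L_row7; congr row7.
  by congr [:: _; _; _; _; _; _; _]; ring.
have E6 : f (e_ K 6) = row7 [:: 0; 0; 0; 0; 0; 0; a0 ^+ 5 * b1].
  rewrite (fL 5 0) // E0 E5 L_row7; congr row7.
  by congr [:: _; _; _; _; _; _; _]; ring.
have coord i j k (lt_k7 : (k < 7)%N) : (i < 7)%N -> (j < 7)%N ->
    f (L_basis c' i j) 0 (Ordinal lt_k7) =
    L c (f (e_ K i)) (f (e_ K j)) 0 (Ordinal lt_k7).
  by move=> i7 j7; rewrite fL.
have nza0 : a0 ^+ 5 * b1 != 0 by rewrite mulf_neq0 ?expf_neq0.
have h00 : c00 c' * (a0 ^+ 5 * b1) =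
    a0 ^+ 2 * c00 c + a0 * a1 * c01 c + a1 ^+ 2 * c11 c.
  have := coord 0 0 6 isT isT isT; rewrite /= linearZ E0 E6 L_row7 !mxE /= => ->.
  ring.
have h01 : c01 c' * (a0 ^+ 5 * b1) = b1 * (a0 * c01 c + 2 * a1 * c11 c).
  have := coord 0 1 6 isT isT isT; have := coord 1 0 6 isT isT isT.
  rewrite /= linearD linearN linearZ E0 E1 E2 E6 !L_row7 !mxE /= => p6E h.
  transitivity (p6 + (- p6 + c01 c' * (a0 ^+ 5 * b1))); first by ring.
  by rewrite h p6E; ring.
have h11 : c11 c' * (a0 ^+ 5 * b1) = b1 ^+ 2 * c11 c.
  have := coord 1 1 6 isT isT isT; rewrite /= linearZ E1 E6 L_row7 !mxE /= => ->.
  ring.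
have h23 : c23 c' * (a0 ^+ 5 * b1) = a0 ^+ 3 * b1 ^+ 2 * c23 c.
  have := coord 2 3 6 isT isT isT; rewrite /= linearZ E2 E3 E6 L_row7 !mxE /= => ->.
  ring.
have f12 : f (L_basis c' 1 2) =
    c12 c' *: f (e_ K 4) + c13 c' *: f (e_ K 5) + c14 c' *: f (e_ K 6).
  by rewrite /= !linearD !linearZ.
have h12 : c12 c' * (a0 ^+ 3 * b1) = a0 * b1 ^+ 2 * c12 c.
  have := coord 1 2 4 isT isT isT; rewrite f12 E1 E2 E4 E5 E6 L_row7 !mxE /=.
  by rewrite !mulr0 !addr0 => ->; ring.
have h13 : c12 c' * (a0 ^+ 3 * b2 - 2 * a0 ^+ 2 * a1 * b1 * c12 c)
    + c13 c' * (a0 ^+ 4 * b1) = a0 * b1 * b2 * c12 c + a0 * b1 ^+ 2 * c13 c.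
  have := coord 1 2 5 isT isT isT; rewrite f12 E1 E2 E4 E5 E6 L_row7 !mxE /=.
  by rewrite mulr0 addr0 => ->; ring.
have h14 := coord 1 2 6 isT isT isT.
rewrite f12 E1 E2 E4 E5 E6 L_row7 !mxE /= in h14.
have c12E : c12 c' = b1 * c12 c / a0 ^+ 2.
  apply: (mulIf (_ : a0 ^+ 3 * b1 != 0)); first by rewrite mulf_neq0 ?expf_neq0.
  by rewrite h12; field.
have c13E : c13 c' = b1 * (a0 * c13 c + 2 * a1 * c12 c ^+ 2) / a0 ^+ 4.
  apply: (mulIf (_ : a0 ^+ 4 * b1 != 0)); first by rewrite mulf_neq0 ?expf_neq0.
  by apply: (addrI _ (etrans h13 _)); rewrite c12E; field.
(* Solve the e6-coordinate of the relation for [e1, e2] for the new c14: the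
   witness for t is, up to the factor a0 / b1, what multiplies c23 there, while
   all of a2, b2, b3 cancel in the part free of c23. *)
exists a0, a1, b1, (a0 ^+ 2 * (b2 ^+ 2 / b1 - 2 * b3)
  - a1 * b1 * (a0 * c13 c + a1 * c12 c ^+ 2)).
split=> //.
case: c' c12E c13E h00 h01 h11 h23 h14 {fM fL coord h12 h13 f12}.
move=> c00' c01' c11' c12' c13' c14' c23' /= -> -> h00 h01 h11 h23 h14.
rewrite /change; congr Params.
- by rewrite -h00 mulfK.
- by apply: (mulIf nza0); rewrite h01; field.
- by apply: (mulIf nza0); rewrite h11; field.
- by apply: (mulIf nza0); apply: (addrI _ (etrans h14 _)); field; rewrite nza nzb.
- by apply: (mulIf nza0); rewrite h23; field.
Qed.

(** Up to the factor 4 c12, this quadratic expression is what remains of c14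
    once a1 has been chosen to kill c13. *)
Lemma change_disc_c12 a0 a1 b1 t c (c' := change a0 a1 b1 t c) :
    a0 != 0 -> c23 c = 0 ->
  4 * c14 c' * c12 c' - 5 * c13 c' ^+ 2 =
  (b1 / a0 ^+ 3) ^+ 2 * (4 * c14 c * c12 c - 5 * c13 c ^+ 2).
Proof. by move=> nza c23_eq0; rewrite /= c23_eq0; field. Qed.

(** This is minus the discriminant of the binary quadratic form
    c00 X^2 + c01 X Y + c11 Y^2, on which (a0, a1; 0, b1) acts by substitution
    up to the normalisation of e6. *)
Lemma change_disc_c11 a0 a1 b1 t c (c' := change a0 a1 b1 t c) :
    a0 != 0 -> b1 != 0 ->
  4 * c00 c' * c11 c' - c01 c' ^+ 2 =
  (4 * c00 c * c11 c - c01 c ^+ 2) / a0 ^+ 8.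
Proof. by move=> nza nzb /=; field; rewrite nza nzb. Qed.

End Change.

(** * Normal forms *)

Local Open Scope classical_set_scope.

(** The isomorphism classes are the orbits of [change], so an orbit claim
    reduces to a normal form and a stability statement about parameters. *)
Lemma single_orbit_change (K : numFieldType) (P : params K -> Prop) r : P r ->
    (forall c, P c ->
      exists a0 a1 b1 t, [/\ a0 != 0, b1 != 0 & change a0 a1 b1 t c = r]) ->
    (forall c a0 a1 b1 t, a0 != 0 -> b1 != 0 -> P c ->
      P (change a0 a1 b1 t c)) ->
  single_orbit [set L c | c in [set c | P c]] (L r).
Proof.
move=> Pr normal_form stable; split; first by exists r.
  have to_r c : P c -> alg_isomorphic (L r) (L c).
    move=> /normal_form[a0 [a1 [b1 [t [nza nzb <-]]]]].
    by apply: isomorphic_change; rewrite ?pnatr_eq0.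
  move=> _ _ [c Pc <-] [c' Pc' <-].
  exact: alg_isomorphic_trans (alg_isomorphic_sym (to_r _ Pc)) (to_r _ Pc').
move=> _ _ [c' _ <-] [c Pc <-].
move=> /change_of_isomorphic[a0 [a1 [b1 [t [nza nzb ->]]]]].
by exists (change a0 a1 b1 t c) => //; apply: stable.
Qed.

Section Orbits.
Variable K : numClosedFieldType.

Lemma nonzero_root n (x : K) : (0 < n)%N -> x != 0 -> exists2 y, y != 0 & y ^+ n = x.
Proof.
move=> n_gt0 nzx; exists (n.-root x); last exact: rootCK.
by rewrite rootC_eq0.
Qed.

Ltac nonzero := repeat first
  [ done | by rewrite pnatr_eq0 | by rewrite oner_neq0 | apply/andP; split
  | apply: mulf_neq0 | apply: expf_neq0 | apply: invr_neq0 ].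
Ltac simplify0 := rewrite ?(mulr0, mul0r, addr0, add0r, subr0, oppr0, expr0n) /=.
Ltac decide_conditions := repeat split; simplify0; nonzero.
Ltac check_normal_form :=
  split;
  [ nonzero | nonzero
  | rewrite /change /=; congr Params; simplify0; field; nonzero ].

(** The equations b1 c23 = a0^2 and c00 = a0^3 b1 for c23 and c00 to become 1 give
    a0^5 = c00 c23; then [t] removes c14. *)
Lemma single_orbit_U7_6 : single_orbit (@U7_6 K) (L (Params 1 0 0 0 0 0 1)).
Proof.
apply: single_orbit_change.
- by decide_conditions.
- move=> [x00 x01 x11 x12 x13 x14 x23] /= [nz23 [-> [-> [-> [-> nz00]]]]].
  have [a nza aE] := @nonzero_root 5 (x00 * x23) isT (mulf_neq0 nz00 nz23).
  have -> : x00 = a ^+ 5 / x23 by rewrite aE mulfK.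
  exists a, 0, (a ^+ 2 / x23), (- (a ^+ 4 * x14 / x23 ^+ 2));
    check_normal_form.
- move=> [x00 x01 x11 x12 x13 x14 x23] a0 a1 b1 t nza nzb /=.
  move=> [nz23 [-> [-> [-> [-> nz00]]]]].
  by decide_conditions.
Qed.

Lemma single_orbit_U7_7 : single_orbit (@U7_7 K) (L (Params 0 0 0 0 0 0 1)).
Proof.
apply: single_orbit_change.
- by decide_conditions.
- move=> [x00 x01 x11 x12 x13 x14 x23] /= [nz23 [-> [-> [-> [-> ->]]]]].
  exists 1, 0, x23^-1, (- (x14 / x23 ^+ 2));
    check_normal_form.
- move=> [x00 x01 x11 x12 x13 x14 x23] a0 a1 b1 t nza nzb /=.
  move=> [nz23 [-> [-> [-> [-> ->]]]]].
  by decide_conditions.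
Qed.

(** The equation b1 c12 = a0^2 makes c12 equal to 1 and the choice of a1 kills
    c13; then c14 becomes the quadratic expression divided by 4 c12^2 a0^2. *)
Lemma single_orbit_U7_11 : single_orbit (@U7_11 K) (L (Params 0 0 0 1 0 1 0)).
Proof.
apply: single_orbit_change.
- by decide_conditions.
- move=> [x00 x01 x11 x12 x13 x14 x23] /= [-> [nz12 [-> [-> [-> disc]]]]].
  have [|a nza aE] := @nonzero_root 2
    ((4 * x14 * x12 - 5 * x13 ^+ 2) / (4 * x12 ^+ 2))
    isT; first by nonzero.
  have -> : x14 = (4 * a ^+ 2 * x12 ^+ 2 + 5 * x13 ^+ 2) / (4 * x12).
    by rewrite aE; field; nonzero.
  exists a, (- (a * x13 / (2 * x12 ^+ 2))), (a ^+ 2 / x12), 0;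
    check_normal_form.
- move=> c a0 a1 b1 t nza nzb [z23 [nz12 [z11 [z01 [z00 disc]]]]].
  rewrite /= change_disc_c12 // /change /= z23 z11 z01 z00.
  by decide_conditions; rewrite ?disc; simplify0.
Qed.

Lemma single_orbit_U7_12 : single_orbit (@U7_12 K) (L (Params 0 0 0 1 0 0 0)).
Proof.
apply: single_orbit_change.
- by decide_conditions.
- move=> [x00 x01 x11 x12 x13 x14 x23] /= [-> [nz12 [-> [-> [-> disc]]]]].
  have -> : x14 = 5 * x13 ^+ 2 / (4 * x12).
    by rewrite -(subr0_eq disc); field; nonzero.
  exists 1, (- (x13 / (2 * x12 ^+ 2))), x12^-1, 0;
    check_normal_form.
- move=> c a0 a1 b1 t nza nzb [z23 [nz12 [z11 [z01 [z00 disc]]]]].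
  rewrite /= change_disc_c12 // /change /= z23 z11 z01 z00.
  by decide_conditions; rewrite ?disc; simplify0.
Qed.

(** The choice of a1 completes the square in the form
    c00 X^2 + c01 X Y + c11 Y^2, and c11 becomes 1 when b1 c11 = a0^5; then
    c00 becomes the quadratic expression divided by 4 a0^8. *)
Lemma single_orbit_U7_15 : single_orbit (@U7_15 K) (L (Params 1 0 1 0 0 0 0)).
Proof.
apply: single_orbit_change.
- by decide_conditions.
- move=> [x00 x01 x11 x12 x13 x14 x23] /= [-> [-> [nz11 [-> [-> disc]]]]].
  have [|a nza aE] := @nonzero_root 8 ((4 * x00 * x11 - x01 ^+ 2) / 4) isT;
    first by nonzero.
  have -> : x00 = (4 * a ^+ 8 + x01 ^+ 2) / (4 * x11).
    by rewrite aE; field; nonzero.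
  exists a, (- (a * x01 / (2 * x11))), (a ^+ 5 / x11), 0;
    check_normal_form.
- move=> c a0 a1 b1 t nza nzb [z23 [z12 [nz11 [z14 [z13 disc]]]]].
  rewrite /= change_disc_c11 // /change /= z23 z12 z14 z13.
  by decide_conditions; rewrite ?disc; simplify0.
Qed.

Lemma single_orbit_U7_16 : single_orbit (@U7_16 K) (L (Params 0 0 1 0 0 0 0)).
Proof.
apply: single_orbit_change.
- by decide_conditions.
- move=> [x00 x01 x11 x12 x13 x14 x23] /= [-> [-> [nz11 [-> [-> disc]]]]].
  have -> : x00 = x01 ^+ 2 / (4 * x11).
    by rewrite -(subr0_eq disc); field; nonzero.
  exists 1, (- (x01 / (2 * x11))), x11^-1, 0;
    check_normal_form.
- move=> c a0 a1 b1 t nza nzb [z23 [z12 [nz11 [z14 [z13 disc]]]]].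
  rewrite /= change_disc_c11 // /change /= z23 z12 z14 z13.
  by decide_conditions; rewrite ?disc; simplify0.
Qed.

(** Here a0^4 = c01, and c00 is removed by a1, on which its new value
    depends linearly. *)
Lemma single_orbit_U7_18 : single_orbit (@U7_18 K) (L (Params 0 1 0 0 1 0 0)).
Proof.
apply: single_orbit_change.
- by decide_conditions.
- move=> [x00 x01 x11 x12 x13 x14 x23] /= [-> [-> [-> [nz01 [-> nz13]]]]].
  have [a nza aE] := @nonzero_root 4 x01 isT nz01.
  have -> : x01 = a ^+ 4 by rewrite aE.
  exists a, (- (x00 / a ^+ 3)), (a ^+ 3 / x13), 0;
    check_normal_form.
- move=> [x00 x01 x11 x12 x13 x14 x23] a0 a1 b1 t nza nzb /=.
  move=> [-> [-> [-> [nz01 [-> nz13]]]]].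
  by decide_conditions.
Qed.

Lemma single_orbit_U7_19 : single_orbit (@U7_19 K) (L (Params 0 1 0 0 0 0 0)).
Proof.
apply: single_orbit_change.
- by decide_conditions.
- move=> [x00 x01 x11 x12 x13 x14 x23] /= [-> [-> [-> [nz01 [-> ->]]]]].
  have [a nza aE] := @nonzero_root 4 x01 isT nz01.
  have -> : x01 = a ^+ 4 by rewrite aE.
  exists a, (- (x00 / a ^+ 3)), 1, 0;
    check_normal_form.
- move=> [x00 x01 x11 x12 x13 x14 x23] a0 a1 b1 t nza nzb /=.
  move=> [-> [-> [-> [nz01 [-> ->]]]]].
  by decide_conditions.
Qed.

(** The equations b1 c13 = a0^3 and c00 = a0^3 b1 give a0^6 = c00 c13. *)
Lemma single_orbit_U7_21 : single_orbit (@U7_21 K) (L (Params 1 0 0 0 1 0 0)).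
Proof.
apply: single_orbit_change.
- by decide_conditions.
- move=> [x00 x01 x11 x12 x13 x14 x23] /= [-> [-> [-> [-> [nz00 [-> nz13]]]]]].
  have [a nza aE] := @nonzero_root 6 (x00 * x13) isT (mulf_neq0 nz00 nz13).
  have -> : x00 = a ^+ 6 / x13 by rewrite aE mulfK.
  exists a, 0, (a ^+ 3 / x13), 0;
    check_normal_form.
- move=> [x00 x01 x11 x12 x13 x14 x23] a0 a1 b1 t nza nzb /=.
  move=> [-> [-> [-> [-> [nz00 [-> nz13]]]]]].
  by decide_conditions.
Qed.

Lemma single_orbit_U7_22 : single_orbit (@U7_22 K) (L (Params 1 0 0 0 0 0 0)).
Proof.
apply: single_orbit_change.
- by decide_conditions.
- move=> [x00 x01 x11 x12 x13 x14 x23] /= [-> [-> [-> [-> [nz00 [-> ->]]]]]].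
  exists 1, 0, x00, 0;
    check_normal_form.
- move=> [x00 x01 x11 x12 x13 x14 x23] a0 a1 b1 t nza nzb /=.
  move=> [-> [-> [-> [-> [nz00 [-> ->]]]]]].
  by decide_conditions.
Qed.

(** The equations b1 c13 = a0^3 and b1 c14 = a0^4 give a0 = c14 / c13. *)
Lemma single_orbit_U7_23 : single_orbit (@U7_23 K) (L (Params 0 0 0 0 1 1 0)).
Proof.
apply: single_orbit_change.
- by decide_conditions.
- move=> [x00 x01 x11 x12 x13 x14 x23] /= [-> [-> [-> [-> [-> [nz14 nz13]]]]]].
  exists (x14 / x13), 0, ((x14 / x13) ^+ 3 / x13), 0;
    check_normal_form.
- move=> [x00 x01 x11 x12 x13 x14 x23] a0 a1 b1 t nza nzb /=.
  move=> [-> [-> [-> [-> [-> [nz14 nz13]]]]]].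
  by decide_conditions.
Qed.

Lemma single_orbit_U7_24 : single_orbit (@U7_24 K) (L (Params 0 0 0 0 0 1 0)).
Proof.
apply: single_orbit_change.
- by decide_conditions.
- move=> [x00 x01 x11 x12 x13 x14 x23] /= [-> [-> [-> [-> [-> [nz14 ->]]]]]].
  exists 1, 0, x14^-1, 0;
    check_normal_form.
- move=> [x00 x01 x11 x12 x13 x14 x23] a0 a1 b1 t nza nzb /=.
  move=> [-> [-> [-> [-> [-> [nz14 ->]]]]]].
  by decide_conditions.
Qed.

Lemma single_orbit_U7_25 : single_orbit (@U7_25 K) (L (Params 0 0 0 0 1 0 0)).
Proof.
apply: single_orbit_change.
- by decide_conditions.
- move=> [x00 x01 x11 x12 x13 x14 x23] /= [-> [-> [-> [-> [-> [-> nz13]]]]]].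
  exists 1, 0, x13^-1, 0;
    check_normal_form.
- move=> [x00 x01 x11 x12 x13 x14 x23] a0 a1 b1 t nza nzb /=.
  move=> [-> [-> [-> [-> [-> [-> nz13]]]]]].
  by decide_conditions.
Qed.

Lemma single_orbit_U7_26 : single_orbit (@U7_26 K) (L (Params 0 0 0 0 0 0 0)).
Proof.
apply: single_orbit_change.
- by decide_conditions.
- move=> [x00 x01 x11 x12 x13 x14 x23] /= [-> [-> [-> [-> [-> [-> ->]]]]]].
  exists 1, 0, 1, 0;
    check_normal_form.
- move=> [x00 x01 x11 x12 x13 x14 x23] a0 a1 b1 t nza nzb /=.
  move=> [-> [-> [-> [-> [-> [-> ->]]]]]].
  by decide_conditions.
Qed.

End Orbits.

Theorem proposition2p13 (R : realType) :
  single_orbit (@U7_6 (complex R)) (L (Params 1 0 0 0 0 0 1)) /\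
  single_orbit (@U7_7 (complex R)) (L (Params 0 0 0 0 0 0 1)) /\
  single_orbit (@U7_11 (complex R)) (L (Params 0 0 0 1 0 1 0)) /\
  single_orbit (@U7_12 (complex R)) (L (Params 0 0 0 1 0 0 0)) /\
  single_orbit (@U7_15 (complex R)) (L (Params 1 0 1 0 0 0 0)) /\
  single_orbit (@U7_16 (complex R)) (L (Params 0 0 1 0 0 0 0)) /\
  single_orbit (@U7_18 (complex R)) (L (Params 0 1 0 0 1 0 0)) /\
  single_orbit (@U7_19 (complex R)) (L (Params 0 1 0 0 0 0 0)) /\
  single_orbit (@U7_21 (complex R)) (L (Params 1 0 0 0 1 0 0)) /\
  single_orbit (@U7_22 (complex R)) (L (Params 1 0 0 0 0 0 0)) /\
  single_orbit (@U7_23 (complex R)) (L (Params 0 0 0 0 1 1 0)) /\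
  single_orbit (@U7_24 (complex R)) (L (Params 0 0 0 0 0 1 0)) /\
  single_orbit (@U7_25 (complex R)) (L (Params 0 0 0 0 1 0 0)) /\
  single_orbit (@U7_26 (complex R)) (L (Params 0 0 0 0 0 0 0)).
Proof.
split; first exact: single_orbit_U7_6.
split; first exact: single_orbit_U7_7.
split; first exact: single_orbit_U7_11.
split; first exact: single_orbit_U7_12.
split; first exact: single_orbit_U7_15.
split; first exact: single_orbit_U7_16.
split; first exact: single_orbit_U7_18.
split; first exact: single_orbit_U7_19.
split; first exact: single_orbit_U7_21.
split; first exact: single_orbit_U7_22.
split; first exact: single_orbit_U7_23.
split; first exact: single_orbit_U7_24.
split; first exact: single_orbit_U7_25.
exact: single_orbit_U7_26.
Qed.
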